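(* Let $J \ge 2$ be an integer and put $x_J = \frac{\pi}{J+1}$. The optimal parameters $\{c_\ell^J\}_{\ell=2}^J$ of the truncated trapezoidal rule of order $J$ (that is, the tuple of real coefficients which is optimal in the sense defined in the context) are given by $$c_2^J = \frac{2\cos x_J}{1+\cos x_J},$$ $$c_\ell^J = (-1)^{J+1-\ell}\,\frac{2^{\ell-1}(1-\cos x_J)}{J+1}\sum_{k=1}^{J-2}(-1)^k\binom{J-k-2}{\ell-3}\,U_k'(\cos x_J),\qquad 3\le \ell\le J.$$
   Context: For an integer $J\ge 2$ and real coefficients $\{c_\ell^J\}_{\ell=2}^J\subset\mathbb{R}$, the truncated trapezoidal rule of order $J$ (TTR$_J$) is the linear multistep method with generating function $\delta_{\mathrm{TTR}_J}:\mathbb{C}\to\mathbb{C}$, $$\delta_{\mathrm{TTR}_J}(\zeta) = (1-\zeta)+\tfrac12(1-\zeta)^2+\sum_{\ell=2}^J 2^{-\ell}c_\ell^J(1-\zeta)^{\ell+1}.$$ The method is called A-stable if $\operatorname{Re}\bigl(\delta_{\mathrm{TTR}_J}(e^{\mathrm{i}\theta})\bigr)\ge 0$ for all $\theta\in[0,2\pi]$. The coefficients $\{c_\ell^J\}_{\ell=2}^J$ are called optimal if this A-stability condition is satisfied and $c_2^J$ is maximal among all real coefficient tuples $(c_2^J,\dots,c_J^J)$ for which the A-stability condition is satisfied. $U_k$ denotes the $k$-th Chebyshev polynomial of the second kind ($U_0=1$, $U_1(y)=2y$, $U_{k+1}(y)=2yU_k(y)-U_{k-1}(y)$), and $U_k'$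 is the derivative of the polynomial $U_k$, so $U_k'(\cos x_J)$ is this derivative evaluated at $\cos x_J$. Binomial coefficients $\binom{n}{k}$ with $k>n\ge0$ are $0$. *)

(* Defs.v *)
From mathcomp Require Import all_boot all_order all_algebra.
From mathcomp Require Import all_classical all_reals all_analysis.
From mathcomp Require Import complex.

Set Implicit Arguments.
Unset Strict Implicit.
Unset Printing Implicit Defensive.

Import Order.TTheory GRing.Theory Num.Theory.

Local Open Scope ring_scope.
Local Open Scope complex_scope.

Fixpoint chebyshevU (R : nzRingType) (k : nat) : {poly R} :=
  match k with
  | 0 => 1
  | k1.+1 => match k1 with
             | 0 => 2 *: 'X
             | k2.+1 => 2 *: 'X * chebyshevU R k1 - chebyshevU R k2
             end
  end.

(* The coefficients (c_2, ..., c_J) are encoded as a function c : nat -> R of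
   which only the values at 2 <= l <= J are ever used. *)
Definition ttr_delta (R : rcfType) (J : nat) (c : nat -> R) (z : R[i]) : R[i] :=
  (1 - z) + (2^-1)%:C * (1 - z) ^+ 2
  + \sum_(2 <= l < J.+1) (2 ^- l * c l)%:C * (1 - z) ^+ l.+1.

Definition expi (R : realType) (theta : R) : R[i] := cos theta +i* sin theta.

Definition A_stable (R : realType) (J : nat) (c : nat -> R) : Prop :=
  forall theta : R, 0 <= theta <= 2 * pi ->
    0 <= complex.Re (ttr_delta J c (expi theta)).

Definition optimal (R : realType) (J : nat) (c : nat -> R) : Prop :=
  A_stable J c /\ (forall d : nat -> R, A_stable J d -> d 2%N <= c 2%N).

(* Main.v *)
Require Import Defs.
From mathcomp Require Import all_boot all_order all_algebra.
From mathcomp Require Import all_classical all_reals all_analysis.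
From mathcomp Require Import complex ring lra zify.

(** Write [zeta = - exp (i a)].  Since
    [(1 + exp (i a)) ^ 2 = 2 (1 + cos a) exp (i a)], every power
    [(1 - zeta) ^ n] with [n >= 4] equals
    [4 (1 + cos a) ^ 2 exp (2 i a) (1 - zeta) ^ (n - 4)], and the terms of lower
    degree have a real part which is also divisible by [(1 + cos a) ^ 2].  Hence
    (lemma [Re_ttr_delta])
      [Re (delta zeta) = (1 + cos a) ^ 2 * F a],
      [F a = f_0 + 2 (f_1 cos a + ... + f_(J-1) cos ((J-1) a))],
    where [f_0 = 1 - c_2 / 2], [f_1 = c_2 / 2], and [f_2, ..., f_(J-1)] are
    obtained from the rescaled [c_3, ..., c_J] by the invertible matrix of binomial
    coefficients.  A-stability means [F >= 0], and [f_2, ..., f_(J-1)] are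
    unconstrained, so maximizing [c_2] is the classical problem of Fejer: bound [f_1] in terms of
    [f_0] for a nonnegative cosine polynomial of degree [J - 1].

    With [N = J + 1] and [x = pi / N], the answer [f_1 <= cos x * f_0]
    (lemma [fejer_ineq]) comes from a quadrature.  The [N] nodes [(2 m + 1) x]
    integrate trigonometric polynomials of degree less than [N] exactly, in
    particular [F a * (cos x - cos a)], and no node lies in the arc
    [cos a > cos x]; so the mean [cos x * f_0 - f_1] of that product is
    nonnegative.

    In the case of equality (lemma [fejer_eq]), [F] vanishes at every node with
    [cos a <> cos x], and so does [F'] because [F >= 0].  The discrete moments of
    [F] and [F'] at the nodes then involve only the nodes [x] and [2 pi - x], and
    give two linear equations for [f_k] and [f_(N-k)], whose solution is
    [N f_k = f_0 * ((N - k) cos (k x) + cos x / sin x * sin (k x))].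
    Conversely this [F] is nonnegative (lemma [fejer_coef_ge0]), since its product
    with [(cos a - cos x) ^ 2] is a positive multiple of [1 + cos (N a)].

    It remains to translate back: [c_2 / 2 = cos x * (1 - c_2 / 2)] gives [c_2];
    binomial inversion gives the other [c_l]; and the numbers
    [sin x ^ 2 * U_k' (cos x)] are, in reverse order, the coefficients of a multiple
    of the extremal [F], as one sees by differentiating
    [sin x * U_k (cos x) = sin ((k + 1) x)]. *)

Set Implicit Arguments.
Unset Strict Implicit.
Unset Printing Implicit Defensive.

Import Order.TTheory GRing.Theory Num.Theory.
Import numFieldNormedType.Exports.

Local Open Scope ring_scope.

(** * Multiples of an angle *)

Lemma mul_sin_cos2 (R : realType) (a b : R) :
  2 * sin a * cos b = sin (b + a) - sin (b - a).
Proof. by rewrite sinB sinD; ring. Qed.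

Lemma mul_cos_cos2 (R : realType) (a b : R) :
  2 * (cos a * cos b) = cos (a - b) + cos (a + b).
Proof. by rewrite cosB cosD; ring. Qed.

Lemma mul_sin_sin2 (R : realType) (a b : R) :
  2 * (sin a * sin b) = cos (a - b) - cos (a + b).
Proof. by rewrite cosB cosD; ring. Qed.

Lemma cos_mulSSn (R : realType) (a : R) k :
  cos (k.+2%:R * a) = 2 * cos a * cos (k.+1%:R * a) - cos (k%:R * a).
Proof.
have -> : k.+2%:R * a = k.+1%:R * a + a by rewrite -[k.+2]addn1 natrD; ring.
have -> : k%:R * a = k.+1%:R * a - a by rewrite -[k.+1]addn1 natrD; ring.
by rewrite cosB cosD; ring.
Qed.

Lemma sin_mulSSn (R : realType) (a : R) k :
  sin (k.+2%:R * a) = 2 * cos a * sin (k.+1%:R * a) - sin (k%:R * a).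
Proof.
have -> : k.+2%:R * a = k.+1%:R * a + a by rewrite -[k.+2]addn1 natrD; ring.
have -> : k%:R * a = k.+1%:R * a - a by rewrite -[k.+1]addn1 natrD; ring.
by rewrite sinB sinD; ring.
Qed.

(** [cos (k a)] is the [k]-th Chebyshev polynomial of the first kind at [cos a];
    the recurrence determines it from [cos a]. *)
Lemma eq_cos_muln (R : realType) (a b : R) k :
  cos a = cos b -> cos (k%:R * a) = cos (k%:R * b).
Proof.
move=> cab; suff [] : cos (k%:R * a) = cos (k%:R * b) /\
  cos (k.+1%:R * a) = cos (k.+1%:R * b) by [].
elim: k => [|k [IH1 IH2]]; first by rewrite !mul0r !mul1r.
by split=> //; rewrite !cos_mulSSn cab IH1 IH2.
Qed.

Lemma sin_muln_eq0 (R : realType) (a : R) k : sin a = 0 -> sin (k%:R * a) = 0.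
Proof.
move=> sa; elim: k => [|k IH]; first by rewrite mul0r sin0.
by rewrite -addn1 natrD mulrDl mul1r sinD IH sa mulr0 mul0r addr0.
Qed.

(** The quotient [sin (k a) / sin a] depends only on [cos a]; the statement is
    cross-multiplied so as to allow a vanishing sine. *)
Lemma sin_muln_cross (R : realType) (a b : R) k :
  cos a = cos b -> sin (k%:R * a) * sin b = sin (k%:R * b) * sin a.
Proof.
move=> cab; suff [] : sin (k%:R * a) * sin b = sin (k%:R * b) * sin a /\
  sin (k.+1%:R * a) * sin b = sin (k.+1%:R * b) * sin a by [].
elim: k => [|k [IH1 IH2]]; first by rewrite !mul0r !mul1r sin0 !mul0r mulrC.
split=> //; rewrite !sin_mulSSn cab !mulrBl IH1.
by rewrite -!mulrA IH2; ring.
Qed.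

(** Telescoping: [2 sin b cos ((2 m + 1) b) = sin ((2 m + 2) b) - sin (2 m b)]. *)
Lemma sum_cos_odd (R : realType) (b : R) n :
  2 * sin b * (\sum_(m < n) cos ((2 * m + 1)%:R * b)) = sin ((2 * n)%:R * b).
Proof.
elim: n => [|n IH]; first by rewrite big_ord0 muln0 mul0r sin0 mulr0.
rewrite big_ord_recr mulrDr IH /= mul_sin_cos2.
have -> : (2 * n + 1)%:R * b + b = (2 * n.+1)%:R * b.
  by rewrite mulnS !natrD; ring.
have -> : (2 * n + 1)%:R * b - b = (2 * n)%:R * b by rewrite natrD; ring.
by ring.
Qed.

Lemma sin_muln_pi (R : realType) k : sin (k%:R * pi) = 0 :> R.
Proof. exact/sin_muln_eq0/sinpi. Qed.

Lemma cos_odd_pi (R : realType) m : cos ((2 * m + 1)%:R * pi) = -1 :> R.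
Proof.
rewrite natrD mulrDl mul1r cosD cospi sinpi mulr0 subr0.
suff -> : cos ((2 * m)%:R * pi) = 1 :> R by rewrite mul1r.
elim: m => [|m IH]; first by rewrite mul0r cos0.
rewrite mulnS natrD mulrDl cosD IH mulr_natl sin2pi cos2pi; ring.
Qed.

Lemma root_angle_gt0 (R : realType) N : (1 < N)%N -> 0 < pi / N%:R :> R.
Proof. by move=> N1; rewrite divr_gt0 ?pi_gt0 // ltr0n; lia. Qed.

Lemma root_angle_mul (R : realType) N : (1 < N)%N -> N%:R * (pi / N%:R) = pi :> R.
Proof. by move=> N1; rewrite mulrC divfK // pnatr_eq0; lia. Qed.

Lemma root_angle_pred (R : realType) N :
  (1 < N)%N -> N.-1%:R * (pi / N%:R) = pi - pi / N%:R :> R.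
Proof.
by move=> N1; rewrite -subn1 natrB ?(ltnW N1) // mulrBl mul1r root_angle_mul.
Qed.

Lemma sin_root_gt0 (R : realType) N k : (0 < k < N)%N ->
  0 < sin (k%:R * (pi / N%:R)) :> R.
Proof.
move=> /andP[k0 kN]; have N1 : (1 < N)%N by lia.
have x0 := root_angle_gt0 R N1.
apply: sin_gt0_pi; rewrite mulr_gt0 ?ltr0n //=.
by rewrite -[ltRHS](root_angle_mul R N1) ltr_pM2r // ltr_nat.
Qed.

Lemma sin_root_neq0 (R : realType) N : (1 < N)%N -> sin (pi / N%:R) != 0 :> R.
Proof. by move=> N1; rewrite -[_ / _]mul1r gt_eqF // (@sin_root_gt0 R N 1). Qed.

(** * Discrete orthogonality *)

(** These are the [N] angles [a] with [cos (N a) = -1].  The sines and cosines of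
    orders below [N] are not orthogonal on them: the orders [k] and [N - k] alias
    there, with a sign, which is why [f (N - k)] enters the moments below. *)
Definition node (R : realType) (N m : nat) : R := (2 * m + 1)%:R * (pi / N%:R).

(** The telescoped sum is [sin (2 k pi) / (2 sin (k pi / N)) = 0] when [N] does not
    divide [k]; for [k = N] every term is [-1]. *)
Lemma sum_cos_node (R : realType) N k : (0 < k < 2 * N)%N ->
  \sum_(m < N) cos (k%:R * node R N m) = - (N%:R *+ (k == N)).
Proof.
move=> /andP[k0 k2N]; have [->|kN] := eqVneq k N.
  rewrite (eq_bigr (fun=> -1)) => [|m _].
    by rewrite sumr_const card_ord mulNrn.
  rewrite /node mulrCA; case: N k0 k2N m => // N _ _ m.
  by rewrite [_.+1%:R * _]mulrC divfK ?pnatr_eq0 // cos_odd_pi.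
have N0 : (0 < N)%N by lia.
have NR : N%:R != 0 :> R by rewrite pnatr_eq0; lia.
rewrite /= mulr0n oppr0; set b : R := k%:R * (pi / N%:R).
have sb : 2 * sin b != 0.
  rewrite mulf_neq0 ?pnatr_eq0 // /b; have [lt|ge] := ltnP k N.
    by rewrite gt_eqF // sin_root_gt0 ?k0.
  rewrite -(subnK ge) natrD mulrDl root_angle_mul ?sinDpi; last by lia.
  by rewrite oppr_eq0 gt_eqF // sin_root_gt0; lia.
apply: (mulfI sb); rewrite mulr0.
under eq_bigr do rewrite /node mulrCA.
rewrite sum_cos_odd natrM -mulrA /b [N%:R * _]mulrCA [N%:R * _]mulrC divfK //.
by rewrite mulrA -natrM sin_muln_pi.
Qed.

Lemma node_cos_orthogonal (R : realType) N j k :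
  (0 < j < N)%N -> (0 < k < N)%N ->
  2 * (\sum_(m < N) cos (j%:R * node R N m) * cos (k%:R * node R N m)) =
  N%:R *+ (j == k) - N%:R *+ (j + k == N)%N.
Proof.
wlog lekj : j k / (k <= j)%N => [hw|] hj hk.
  have [kj|/ltnW jk] := leqP k j; first exact: hw.
  rewrite addnC eq_sym -(hw k j) //.
  by congr (_ * _); apply: eq_bigr => m _; rewrite mulrC.
rewrite mulr_sumr; under eq_bigr do
  rewrite mul_cos_cos2 -mulrBl -mulrDl -natrB // -natrD.
rewrite big_split /= [X in _ + X]sum_cos_node; last by lia.
congr (_ - _); have [->|ne] := eqVneq j k.
  by rewrite subnn; under eq_bigr do rewrite mul0r cos0; rewrite sumr_const card_ord.
rewrite sum_cos_node; last by lia.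
have -> : (j - k == N)%N = false by lia.
by rewrite mulr0n oppr0.
Qed.

Lemma node_sin_orthogonal (R : realType) N j k :
  (0 < j < N)%N -> (0 < k < N)%N ->
  2 * (\sum_(m < N) sin (j%:R * node R N m) * sin (k%:R * node R N m)) =
  N%:R *+ (j == k) + N%:R *+ (j + k == N)%N.
Proof.
wlog lekj : j k / (k <= j)%N => [hw|] hj hk.
  have [kj|/ltnW jk] := leqP k j; first exact: hw.
  rewrite addnC eq_sym -(hw k j) //.
  by congr (_ * _); apply: eq_bigr => m _; rewrite mulrC.
rewrite mulr_sumr; under eq_bigr do
  rewrite mul_sin_sin2 -mulrBl -mulrDl -natrB // -natrD.
rewrite sumrB [X in _ - X]sum_cos_node; last by lia.
rewrite opprK; congr (_ + _); have [->|ne] := eqVneq j k.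
  by rewrite subnn; under eq_bigr do rewrite mul0r cos0; rewrite sumr_const card_ord.
rewrite sum_cos_node; last by lia.
have -> : (j - k == N)%N = false by lia.
by rewrite mulr0n oppr0.
Qed.

(** * Cosine polynomials and their moments at the nodes *)

Definition cosine_poly (R : realType) (N : nat) (f : nat -> R) (a : R) : R :=
  f 0%N + 2 * \sum_(1 <= k < N) f k * cos (k%:R * a).

Definition cosine_poly_deriv (R : realType) (N : nat) (f : nat -> R) (a : R) : R :=
  - (2 * \sum_(1 <= k < N) k%:R * f k * sin (k%:R * a)).

Lemma is_derive_cosine_poly (R : realType) N (f : nat -> R) (a : R) :
  is_derive a 1 (cosine_poly N f) (cosine_poly_deriv N f a).
Proof.
elim: N => [|N IH].
  rewrite /cosine_poly_deriv /cosine_poly big_geq // mulr0 oppr0.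
  under eq_fun do rewrite big_geq // mulr0 addr0.
  exact: is_derive_cst.
case: N IH => [|N] IH.
  rewrite /cosine_poly_deriv /cosine_poly big_geq // mulr0 oppr0.
  under eq_fun do rewrite big_geq // mulr0 addr0.
  exact: is_derive_cst.
have -> : cosine_poly N.+2 f = (fun t => cosine_poly N.+1 f t +
    2 * f N.+1 * cos (N.+1%:R * t)).
  by apply/funext => t; rewrite /cosine_poly big_nat_recr //=; ring.
have -> : cosine_poly_deriv N.+2 f a = cosine_poly_deriv N.+1 f a +
    2 * f N.+1 * (- (N.+1%:R * sin (N.+1%:R * a))).
  by rewrite /cosine_poly_deriv big_nat_recr //=; ring.
apply: is_deriveD; apply: is_deriveZ.
apply: is_derive_eq.
by rewrite /GRing.scale /= mulr1; ring.
Qed.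

Lemma big_nat_delta (R : realType) N (f : nat -> R) k : (0 < k < N)%N ->
  \sum_(1 <= j < N) f j *+ (j == k) = f k.
Proof.
move=> hk; under eq_bigr do rewrite mulrb.
by rewrite -big_mkcond /= big_nat1_eq hk.
Qed.

Lemma cosine_poly_node_mean (R : realType) N (f : nat -> R) :
  \sum_(m < N) cosine_poly N f (node R N m) = N%:R * f 0%N.
Proof.
rewrite big_split /= sumr_const card_ord -mulr_sumr exchange_big /=.
rewrite big_nat big1 => [|k hk]; first by rewrite mulr0 addr0 mulr_natl.
rewrite -mulr_sumr sum_cos_node; last by lia.
by rewrite (_ : (k == N) = false) ?oppr0 ?mulr0 //; lia.
Qed.

(** The true moment would be [f k]; sampling at the nodes adds the alias
    [- f (N - k)]. *)
Lemma cosine_poly_node_moment (R : realType) N (f : nat -> R) k : (0 < k < N)%N ->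
  \sum_(m < N) cosine_poly N f (node R N m) * cos (k%:R * node R N m) =
  N%:R * (f k - f (N - k)%N).
Proof.
move=> hk; under eq_bigr do rewrite mulrDl.
rewrite big_split /= -mulr_sumr sum_cos_node; last by lia.
rewrite (_ : (k == N) = false) ?oppr0 ?mulr0 ?add0r; last by lia.
under eq_bigr do rewrite -mulrA mulr_suml mulr_sumr.
rewrite exchange_big /= mulrBr.
rewrite -[X in N%:R * X - _](@big_nat_delta _ N) //.
rewrite -[X in _ - N%:R * X](@big_nat_delta _ N); last by lia.
rewrite !mulr_sumr -sumrB; apply: eq_big_nat => j hj.
rewrite !mulrnAr -!mulrnAl.
have -> : (j == N - k)%N = (j + k == N)%N by lia.
rewrite -mulrBl -node_cos_orthogonal // mulr_sumr mulr_suml.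
by apply: eq_bigr => m _; ring.
Qed.

Lemma cosine_poly_deriv_node_moment (R : realType) N (f : nat -> R) k :
  (0 < k < N)%N ->
  \sum_(m < N) cosine_poly_deriv N f (node R N m) * sin (k%:R * node R N m) =
  - (N%:R * (k%:R * f k + (N - k)%:R * f (N - k)%N)).
Proof.
move=> hk; under eq_bigr do rewrite mulNr -mulrA mulr_suml mulr_sumr.
rewrite sumrN exchange_big /= mulrDr; congr (- _).
rewrite -[X in N%:R * X + _](@big_nat_delta _ N (fun j => j%:R * f j)) //.
rewrite -[X in _ + N%:R * X](@big_nat_delta _ N (fun j => j%:R * f j)); last by lia.
rewrite !mulr_sumr -big_split /=; apply: eq_big_nat => j hj.
rewrite !mulrnAr -!mulrnAl.
have -> : (j == N - k)%N = (j + k == N)%N by lia.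
rewrite -mulrDl -node_sin_orthogonal // mulr_sumr mulr_suml.
by apply: eq_bigr => m _; ring.
Qed.

(** The nodes avoid the open arc of half-width [pi / N] around [0], the only place
    where [cos a] exceeds [cos (pi / N)]. *)
Lemma cos_node_le (R : realType) N m : (1 < N)%N -> (m < N)%N ->
  cos (node R N m) <= cos (pi / N%:R).
Proof.
move=> N1 mN; rewrite /node; set x : R := pi / N%:R.
have x0 : 0 < x := root_angle_gt0 R N1.
have Nx : N%:R * x = pi := root_angle_mul R N1.
have N1R : 1 <= N%:R :> R by rewrite ler1n; lia.
have mNR : m%:R + 1 <= N%:R :> R by rewrite natr1 ler_nat.
have m0R : 0 <= m%:R :> R by [].
have xpi : x <= pi by rewrite -Nx; nra.
have h (t : R) : x <= t <= pi -> cos t <= cos x.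
  move=> /andP[xt tpi]; have [->//|ne] := eqVneq t x.
  apply: ltW; rewrite ltr_cos ?in_itv /=; last 2 first; lra.
rewrite natrD natrM.
have [le|gt] := leP ((2 * m%:R + 1) * x) pi.
  by apply: h; rewrite le andbT; nra.
rewrite -cosN -cosD2pi; apply: h; rewrite -mulr_natl.
by apply/andP; split; nra.
Qed.

(** * Nonnegativity and continuity *)

(** The cosine cannot take its value at [a] both at [a + h] and at [a - h] for small
    [h > 0]: the sum and the difference of the two equations would force
    [cos a = 0] and [sin a = 0]. *)
Lemma exists_near_cos_neq (R : realType) (a e : R) : 0 < e ->
  exists2 b, `|b - a| < e & cos b != cos a.
Proof.
move=> e0; set h := Num.min (e / 2) (pi / 2).
have p0 := pi_gt0 R.
have h0 : 0 < h by rewrite lt_min; apply/andP; split; lra.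
have he : h <= e / 2 by rewrite ge_min lexx.
have hp : h <= pi / 2 by rewrite ge_min lexx orbT.
have sh : 0 < sin h by apply: sin_gt0_pi; apply/andP; split; lra.
have ch : cos h ^+ 2 + sin h ^+ 2 = 1 := cos2Dsin2 h.
have ca : cos a ^+ 2 + sin a ^+ 2 = 1 := cos2Dsin2 a.
have [/eqP e1|ne] := boolP (cos (a + h) == cos a); last first.
  by exists (a + h) => //; rewrite addrAC subrr add0r gtr0_norm //; lra.
exists (a - h); first by rewrite addrAC subrr add0r normrN gtr0_norm //; lra.
apply/eqP => e2; move: e1 e2; rewrite cosD cosB => e1 e2.
have sa : sin a = 0 by apply: (mulIf (lt0r_neq0 sh)); lra.
rewrite sa in ca e1; have ca0 : cos a != 0.
  by apply/eqP => c0; rewrite c0 in ca; lra.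
have ch1 : cos h = 1 by apply: (mulfI ca0); lra.
rewrite ch1 in ch; have : sin h ^+ 2 = 0 by lra.
by move=> /eqP; rewrite sqrf_eq0 gt_eqF.
Qed.

(** Needed since the factorizations of [F] used here divide by [1 + cos a] or by
    [cos a - cos x], and so say nothing where these vanish. *)
Lemma ge0_off_cos_level (R : realType) (F : R -> R) (y : R) :
  continuous F -> (forall t, cos t != y -> 0 <= F t) -> forall t, 0 <= F t.
Proof.
move=> Fc F0 t; have [ty|] := eqVneq (cos t) y; last exact: F0.
rewrite leNgt; apply/negP => Ft.
have /nbhs_ballP[e /= e0 he] : \forall s \near t, F s < 0.
  have := Fc t; move/cvgr_lt; exact.
have [b be bt] := exists_near_cos_neq t e0.
have : F b < 0 by apply: he; rewrite /ball /= distrC.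
by rewrite ltNge F0 // -ty.
Qed.

Lemma derive_eq0_at_zero_of_ge0 (R : realType) (F : R -> R) (a dF : R) :
  (forall t, derivable F t 1) -> (forall t, 0 <= F t) -> F a = 0 ->
  is_derive a 1 F dF -> dF = 0.
Proof.
move=> Fd F0 Fa dFa.
have h : is_derive a 1 F 0.
  apply: (@derive1_at_min R F (a - 1) (a + 1)).
  - lra.
  - by move=> t _; exact: Fd.
  - by rewrite in_itv /=; apply/andP; split; lra.
  - by move=> t _; rewrite Fa F0.
by rewrite -(@derive_val _ _ _ _ _ _ _ dFa) (@derive_val _ _ _ _ _ _ _ h).
Qed.

(** * The extremal problem of Fejer *)

Lemma cosine_poly_weighted_mean (R : realType) N (f : nat -> R) :
  (1 < N)%N -> f N.-1 = 0 ->
  \sum_(m < N) cosine_poly N f (node R N m) *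
    (cos (pi / N%:R) - cos (node R N m)) =
  N%:R * (cos (pi / N%:R) * f 0%N - f 1%N).
Proof.
move=> N1 fN; under eq_bigr do rewrite mulrBr -[X in _ - _ * cos X]mul1r.
rewrite sumrB -mulr_suml cosine_poly_node_mean.
by rewrite (@cosine_poly_node_moment _ _ _ 1) // subn1 fN; ring.
Qed.

(** [N * (cos x * f_0 - f_1)] is the sum of [F a * (cos x - cos a)] over the nodes,
    where both factors are nonnegative.  The hypothesis [f N.-1 = 0] removes the
    alias of [f_1]. *)
Lemma fejer_ineq (R : realType) N (f : nat -> R) :
  (1 < N)%N -> f N.-1 = 0 -> (forall a, 0 <= cosine_poly N f a) ->
  f 1%N <= cos (pi / N%:R) * f 0%N.
Proof.
move=> N1 fN F0; rewrite -subr_ge0.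
have NR : 0 < N%:R :> R by rewrite ltr0n; lia.
rewrite -(pmulr_rge0 _ NR) -cosine_poly_weighted_mean //.
by apply: sumr_ge0 => m _; rewrite mulr_ge0 // subr_ge0 cos_node_le.
Qed.

(** The autocorrelations of the sequence [sin (pi / N), sin (2 pi / N), ...], up to
    a factor: the coefficients of the squared modulus of the polynomial extremal for
    the inequality of Fejer. *)
Definition fejer_coef (R : realType) (N k : nat) : R :=
  let x := pi / N%:R in
  (N%:R - k%:R) * cos (k%:R * x) + cos x / sin x * sin (k%:R * x).

(** Equality makes every term of the quadrature vanish, so [F] and [F'] are
    supported on the nodes where [cos a = cos x].  There [cos (k a)] and
    [sin (k a) / sin a] have the values taken at [x], so each moment of order [k] is
    a multiple of one of low order:
    [f_k - f_(N-k) = cos (k x) f_0] and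
    [(k f_k + (N - k) f_(N-k)) sin x = sin (k x) f_1]. *)
Lemma fejer_eq (R : realType) N (f : nat -> R) :
  (1 < N)%N -> f N.-1 = 0 -> (forall a, 0 <= cosine_poly N f a) ->
  f 1%N = cos (pi / N%:R) * f 0%N ->
  forall k, (0 < k < N)%N -> f k = f 0%N / N%:R * fejer_coef R N k.
Proof.
move=> N1 fN F0 f1 k hk; rewrite /fejer_coef; set x : R := pi / N%:R in f1 *.
have NR : N%:R != 0 :> R by rewrite pnatr_eq0; lia.
have sx : sin x != 0 := sin_root_neq0 R N1.
have zero m : (m < N)%N -> cos (node R N m) != cos x ->
    cosine_poly N f (node R N m) = 0.
  move=> mN cne.
  have /psumr_eq0P/(_ (Ordinal mN) isT)/eqP : \sum_(m < N)
      cosine_poly N f (node R N m) * (cos x - cos (node R N m)) = 0.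
    by rewrite cosine_poly_weighted_mean // -/x f1 subrr mulr0.
  rewrite /= mulf_eq0 subr_eq0 [cos x == _]eq_sym (negbTE cne) orbF.
  move=> h; apply/eqP; apply: h => i _.
  by rewrite mulr_ge0 // subr_ge0 cos_node_le.
have dzero m : (m < N)%N -> cos (node R N m) != cos x ->
    cosine_poly_deriv N f (node R N m) = 0.
  move=> mN cne; apply: (derive_eq0_at_zero_of_ge0 _ F0 (zero m mN cne)).
    by move=> t; have [] := is_derive_cosine_poly N f t.
  exact: is_derive_cosine_poly.
have eq1 : f k - f (N - k)%N = cos (k%:R * x) * f 0%N.
  apply: (mulfI NR); rewrite -cosine_poly_node_moment // mulrCA.
  rewrite -cosine_poly_node_mean mulr_sumr; apply: eq_bigr => m _.
  have [cx|/zero-> //] := eqVneq (cos (node R N m)) (cos x).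
    by rewrite (eq_cos_muln _ cx) mulrC.
  by rewrite mul0r mulr0.
have eq2 : (k%:R * f k + (N - k)%:R * f (N - k)%N) * sin x =
    sin (k%:R * x) * f 1%N.
  have h1 := @cosine_poly_deriv_node_moment R N f 1 N1.
  rewrite subn1 fN mulr0 addr0 mul1r in h1.
  apply: (mulfI NR); apply: oppr_inj.
  rewrite mulrA -mulNr -cosine_poly_deriv_node_moment //.
  rewrite [in RHS]mulrCA -mulrN -h1 mulr_suml mulr_sumr; apply: eq_bigr => m _.
  have [cx|/dzero-> //] := eqVneq (cos (node R N m)) (cos x).
    by rewrite -mulrA (sin_muln_cross _ cx) mul1r; ring.
  by rewrite !mul0r mulr0.
have kN : (N - k)%:R = N%:R - k%:R :> R by rewrite natrB //; lia.
have eq3 : f (N - k)%N = f k - cos (k%:R * x) * f 0%N by lra.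
move: eq2; rewrite eq3 kN f1 => eq2.
apply: (mulfI NR); apply: (mulIf sx).
have -> : N%:R * (f 0%N / N%:R * ((N%:R - k%:R) * cos (k%:R * x) +
  cos x / sin x * sin (k%:R * x))) * sin x =
  f 0%N * ((N%:R - k%:R) * cos (k%:R * x) * sin x + cos x * sin (k%:R * x)).
  by field; rewrite NR sx.
lra.
Qed.

(** The action on coefficients of the multiplication by [cos a - y]; the value at
    [0] reflects the even extension [e (-1) = e 1]. *)
Definition second_diff (R : realType) (y : R) (e : nat -> R) (k : nat) : R :=
  if k is k'.+1 then (e k.+1 + e k') / 2 - y * e k else e 1%N - y * e 0%N.

(** The two correction terms come from cutting off the sequence after [e n]; they
    vanish when [e n = e n.+1 = 0]. *)
Lemma mul_cosine_poly (R : realType) (y : R) (e : nat -> R) n (a : R) :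
  (cos a - y) * cosine_poly n.+1 e a =
  cosine_poly n.+1 (second_diff y e) a +
  e n * cos (n.+1%:R * a) - e n.+1 * cos (n%:R * a).
Proof.
elim: n => [|n IH].
  by rewrite /cosine_poly !big_geq //= mul1r mul0r cos0; ring.
have rec (g : nat -> R) : cosine_poly n.+2 g a =
    cosine_poly n.+1 g a + 2 * g n.+1 * cos (n.+1%:R * a).
  by rewrite /cosine_poly big_nat_recr //=; ring.
by rewrite !rec mulrDr IH /= [cos (n.+2%:R * a)]cos_mulSSn; field.
Qed.

Lemma eq_cosine_poly (R : realType) N (f g : nat -> R) (a : R) :
  (0 < N)%N -> (forall k, (k < N)%N -> f k = g k) ->
  cosine_poly N f a = cosine_poly N g a.
Proof.
move=> N0 fg; rewrite /cosine_poly fg //; congr (_ + _ * _).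
by apply: eq_big_nat => k /andP[_ /fg->].
Qed.

Lemma fejer_coef0 (R : realType) N : fejer_coef R N 0 = N%:R.
Proof. by rewrite /fejer_coef /= mul0r cos0 sin0; ring. Qed.

Lemma fejer_coef1 (R : realType) N : (1 < N)%N ->
  fejer_coef R N 1 = N%:R * cos (pi / N%:R).
Proof.
move=> N1; rewrite /fejer_coef mul1r.
have sx := sin_root_neq0 R N1.
by field.
Qed.

Lemma fejer_coef_pred (R : realType) N : (1 < N)%N -> fejer_coef R N N.-1 = 0.
Proof.
move=> N1; rewrite /fejer_coef /=.
have sx := sin_root_neq0 R N1.
rewrite root_angle_pred //.
have -> : N.-1%:R = N%:R - 1 :> R by rewrite -subn1 natrB //; lia.
rewrite cosB sinB cospi sinpi.
by field.
Qed.

(** Applying [second_diff (cos x)] once to [fejer_coef] yields [sin x * sin (k x)],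
    and twice kills everything but the constant term.  Collecting the boundary terms,
    [(cos a - cos x) ^ 2 * F a = sin x ^ 2 * (1 + cos (N a))]. *)
Lemma fejer_coef_ge0 (R : realType) N : (1 < N)%N ->
  forall a : R, 0 <= cosine_poly N (fejer_coef R N) a.
Proof.
move=> N1; set x : R := pi / N%:R.
have sx : sin x != 0 := sin_root_neq0 R N1.
have csx : cos x ^+ 2 = 1 - sin x ^+ 2 := cos2sin2 x.
have NE : N = N.-1.+1 by lia.
have d1 k : second_diff (cos x) (fejer_coef R N) k = sin x * sin (k%:R * x).
  case: k => [|k]; first by rewrite /= fejer_coef0 fejer_coef1 // mul0r sin0; ring.
  rewrite /= /fejer_coef /= -/x cos_mulSSn sin_mulSSn.
  have kx : k%:R * x = k.+1%:R * x - x by rewrite -natr1; ring.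
  rewrite kx cosB sinB.
  rewrite -[k.+2]addn2 -[k.+1]addn1 !natrD.
  by field: csx.
have d2 k : second_diff (cos x) (fun j => sin x * sin (j%:R * x)) k =
    sin x ^+ 2 *+ (k == 0)%N.
  case: k => [|k]; first by rewrite /= mul0r mul1r sin0; ring.
  by rewrite /= sin_mulSSn mulr0n; field.
have key a : (cos a - cos x) ^+ 2 * cosine_poly N (fejer_coef R N) a =
    sin x ^+ 2 * (1 + cos (N%:R * a)).
  have mulx e : (cos a - cos x) * cosine_poly N e a =
      cosine_poly N (second_diff (cos x) e) a +
      e N.-1 * cos (N%:R * a) - e N * cos (N.-1%:R * a).
    by rewrite NE mul_cosine_poly.
  rewrite expr2 -mulrA mulx fejer_coef_pred //.
  have -> : fejer_coef R N N = 0.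
    by rewrite /fejer_coef subrr mul0r root_angle_mul // sinpi mulr0 addr0.
  rewrite !mul0r subr0 addr0.
  rewrite (@eq_cosine_poly _ _ _ _ _ _ (fun k _ => d1 k)); last by lia.
  rewrite mulx (@eq_cosine_poly _ _ _ _ _ _ (fun k _ => d2 k)); last by lia.
  rewrite root_angle_pred // sinB sinpi cospi root_angle_mul // sinpi mulr0 mul0r subr0.
  rewrite /cosine_poly big_nat big1 => [|k hk]; last first.
    by case: k hk => // k; rewrite mulr0n mul0r.
  by rewrite mulr1n; ring.
apply: (@ge0_off_cos_level _ _ (cos x)) => t.
  apply: differentiable_continuous; apply/derivable1_diffP.
  by have [] := is_derive_cosine_poly N (fejer_coef R N) t.
rewrite -subr_eq0 => ct; have c2 : 0 < (cos t - cos x) ^+ 2.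
  by rewrite lt0r sqrf_eq0 ct sqr_ge0.
rewrite -(pmulr_rge0 _ c2) key mulr_ge0 ?sqr_ge0 //.
Qed.

(** * The real part of the generating function *)

(** Coefficients of the cosine polynomial left after division of the real part of
    the generating function by [(1 + cos a) ^ 2]. *)
Definition ttr_coef (R : realType) (J : nat) (c : nat -> R) (k : nat) : R :=
  match k with
  | 0 => 1 - c 2%N / 2
  | 1 => c 2%N / 2
  | i.+2 => \sum_(j < J.-2) 'C(j, i)%:R * (2 ^- j.+2 * c j.+3)
  end.

Lemma ReD (R : rcfType) (z w : R[i]) :
  complex.Re (z + w) = complex.Re z + complex.Re w.
Proof. by case: z w => [a b] [c d]. Qed.

Lemma ReZ (R : rcfType) (k : R) (z : R[i]) :
  complex.Re (k%:C%C * z) = k * complex.Re z.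
Proof. by case: z => [a b]; rewrite /= mul0r subr0. Qed.

Lemma Re_sum (R : rcfType) (I : Type) (r : seq I) (P : pred I) (F : I -> R[i]) :
  complex.Re (\sum_(i <- r | P i) F i) = \sum_(i <- r | P i) complex.Re (F i).
Proof. by apply: big_morph => //; exact: ReD. Qed.

Lemma expi_exp (R : realType) (a : R) n : expi a ^+ n = expi (n%:R * a).
Proof.
elim: n => [|n IH]; first by rewrite expr0 mul0r /expi cos0 sin0.
rewrite exprSr IH -natr1 mulrDl mul1r /expi cosD sinD.
by apply/eqP; rewrite eq_complex /= eqxx /= addrC; apply/eqP; ring.
Qed.

Lemma expiDpi (R : realType) (a : R) : expi (a + pi) = - expi a.
Proof. by rewrite /expi cosDpi sinDpi. Qed.

Lemma sqr_1Dexpi (R : realType) (a : R) :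
  (1 + expi a) ^+ 2 = (2 * (1 + cos a))%:C%C * expi a.
Proof.
apply/eqP; rewrite eq_complex expr2 /=; have := cos2Dsin2 a.
by move=> h; apply/andP; split; apply/eqP; lra.
Qed.

Lemma Re_expi2_binomial (R : realType) (a : R) j M : (j < M)%N ->
  complex.Re (expi a ^+ 2 * (1 + expi a) ^+ j) =
  \sum_(i < M) 'C(j, i)%:R * cos (i.+2%:R * a).
Proof.
move=> jM; rewrite addrC exprD1n mulr_sumr Re_sum.
rewrite (big_ord_widen_cond M xpredT (fun i => complex.Re (expi a ^+ 2 *
  (expi a ^+ i *+ 'C(j, i))))) //= [LHS]big_mkcond /=.
apply: eq_bigr => i _; case: ifPn => ij.
  by rewrite -mulr_natl mulrCA -exprD -(rmorph_nat (real_complex R)) ReZ expi_exp.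
by rewrite bin_small ?mul0r //; lia.
Qed.

Lemma ttr_coef_last (R : realType) J (c : nat -> R) : (2 <= J)%N ->
  ttr_coef J c J = 0.
Proof.
by case: J => [|[|M]] // _; rewrite /= big1 // => j _; rewrite bin_small ?mul0r.
Qed.

Lemma cosine_poly_ttr_coef (R : realType) M (c : nat -> R) (a : R) :
  cosine_poly M.+3 (ttr_coef M.+2 c) a =
  (1 - c 2%N / 2) + c 2%N * cos a + 2 * \sum_(j < M) (2 ^- j.+2 * c j.+3) *
     \sum_(i < M) 'C(j, i)%:R * cos (i.+2%:R * a).
Proof.
rewrite /cosine_poly big_ltn // mul1r.
rewrite [X in 2 * (_ + X)](_ : _ =
  \sum_(i < M) ttr_coef M.+2 c i.+2 * cos (i.+2%:R * a)).
  have -> : \sum_(i < M) ttr_coef M.+2 c i.+2 * cos (i.+2%:R * a) =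
    \sum_(j < M) (2 ^- j.+2 * c j.+3) * \sum_(i < M) 'C(j, i)%:R * cos (i.+2%:R * a).
    under eq_bigr do rewrite /= mulr_suml.
    rewrite exchange_big; apply: eq_bigr => j _ /=.
    by rewrite mulr_sumr; apply: eq_bigr => i _; ring.
  by rewrite /=; field.
rewrite -[2%N]add0n big_addn big_mkord subn2 big_ord_recr addn2.
rewrite ttr_coef_last // mul0r /= addr0.
by apply: eq_bigr => i _; rewrite addn2.
Qed.

Lemma Re_ttr_delta (R : realType) J (c : nat -> R) (a : R) : (2 <= J)%N ->
  complex.Re (ttr_delta J c (expi (a + pi))) =
  (1 + cos a) ^+ 2 * cosine_poly J.+1 (ttr_coef J c) a.
Proof.
case: J => [|[|M]] // _; rewrite cosine_poly_ttr_coef /ttr_delta expiDpi opprK.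
rewrite big_ltn // -[3%N]add0n big_addn big_mkord subSS subSS.
rewrite subn1 /= !ReD !ReZ Re_sum.
have cs := sin2cos2 a.
have e2 : complex.Re ((1 + expi a) ^+ 2) = 2 * (1 + cos a) * cos a.
  by rewrite sqr_1Dexpi ReZ.
have e3 : complex.Re ((1 + expi a) ^+ 3) =
    2 * (1 + cos a) ^+ 2 * (2 * cos a - 1).
  by rewrite exprS sqr_1Dexpi mulrCA ReZ /=; ring: cs.
have e4 (j : 'I_M) : complex.Re ((2 ^- (j + 3) * c (j + 3)%N)%:C%C *
    (1 + expi a) ^+ (j + 3).+1) = (1 + cos a) ^+ 2 * (2 *
    ((2 ^- j.+2 * c j.+3) * \sum_(i < M) 'C(j, i)%:R * cos (i.+2%:R * a))).
  rewrite ReZ (_ : (j + 3).+1%N = (2 * 2 + j)%N); last by lia.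
  rewrite [(1 + _) ^+ _]exprD exprM sqr_1Dexpi exprMn -[in complex.Re _]mulrA.
  rewrite -[X in X * (_ * _)](rmorphXn (real_complex R)) ReZ.
  rewrite (@Re_expi2_binomial _ _ _ M) // addn3 [in 2 ^- j.+3]exprS invfM.
  by field.
rewrite (eq_bigr _ (fun j _ => e4 j)).
rewrite -!mulr_sumr e2 e3 /=.
by field.
Qed.

Lemma expi_cover (R : realType) (a : R) : exists2 t : R,
  0 <= t <= 2 * pi & cos t = - cos a.
Proof.
have ca : -1 <= - cos a <= 1 by have := cos_geN1 a; have := cos_le1 a; lra.
exists (acos (- cos a)); last by rewrite acosK.
have := acos_ge0 ca; have := acos_lepi ca; have := pi_ge0 R; lra.
Qed.

(** The angle is shifted by [pi], so that the fourth-order zero of the real part is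
    at [a = pi]; nonnegativity of the quotient there follows by continuity. *)
Lemma A_stable_cosine_poly (R : realType) J (c : nat -> R) : (2 <= J)%N ->
  A_stable J c <-> forall a, 0 <= cosine_poly J.+1 (ttr_coef J c) a.
Proof.
move=> J2; split=> [st|nn t _]; last first.
  by rewrite -[t](subrK pi) Re_ttr_delta // mulr_ge0 ?sqr_ge0.
have Fc : continuous (cosine_poly J.+1 (ttr_coef J c)).
  move=> a; apply: differentiable_continuous; apply/derivable1_diffP.
  by have [] := is_derive_cosine_poly J.+1 (ttr_coef J c) a.
apply: (@ge0_off_cos_level _ _ (-1)) => // a ca.
have [t tpi ct] := expi_cover a.
have -> : cosine_poly J.+1 (ttr_coef J c) a =
    cosine_poly J.+1 (ttr_coef J c) (t - pi).
  rewrite /cosine_poly; congr (_ + _ * _); apply: eq_bigr => k _; congr (_ * _).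
  by apply: eq_cos_muln; rewrite cosB cospi sinpi ct; ring.
have c2 : 0 < (1 + cos (t - pi)) ^+ 2.
  rewrite lt0r sqrf_eq0 sqr_ge0 andbT cosB cospi sinpi ct mulr0 addr0 mulrN1 opprK.
  by rewrite addrC -[1]opprK subr_eq0.
by rewrite -(pmulr_rge0 _ c2) -Re_ttr_delta // subrK st.
Qed.

(** * Binomial inversion *)

Lemma coef_X1_exp (R : comNzRingType) (n j : nat) :
  (('X + 1 : {poly R}) ^+ n)`_j = 'C(n, j)%:R.
Proof.
rewrite exprD1n coef_sum; under eq_bigr do rewrite coefMn coefXn.
have [jn|nj] := ltnP j n.+1.
  rewrite (bigD1 (Ordinal jn)) //= eqxx big1 ?addr0 // => i ne.
  rewrite (_ : (j == i :> nat) = false) ?mul0rn //.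
  by apply: contraNF ne => /eqP ji; apply/eqP/val_inj.
rewrite bin_small // big1 // => i _.
by rewrite (_ : (j == i :> nat) = false) ?mul0rn //; have := ltn_ord i; lia.
Qed.

(** Compare the coefficients of ['X ^+ k = (('X + 1) - 1) ^+ k]. *)
Lemma sum_sign_bin_bin (R : comNzRingType) (k j : nat) :
  \sum_(i < k.+1) (-1) ^+ (k - i) * 'C(k, i)%:R * 'C(i, j)%:R = (k == j)%:R :> R.
Proof.
have : ('X ^+ k : {poly R}) = (('X + 1) - 1) ^+ k by rewrite addrK.
move=> /(congr1 (fun p : {poly R} => p`_j)); rewrite coefXn eq_sym => ->.
rewrite exprDn coef_sum; rewrite [LHS](reindex_inj rev_ord_inj) /=.
apply: eq_bigr => i _; have ik : (i <= k)%N by rewrite -ltnS.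
rewrite subSS subKn // bin_sub // coefMn.
rewrite (_ : -1 = (-1)%:P :> {poly R}); last by rewrite polyCN.
rewrite -polyC_exp coefMC coef_X1_exp.
by rewrite -mulr_natl; ring.
Qed.

Lemma binomial_inversion (R : comNzRingType) M (f g : nat -> R) :
  (forall i, (i < M)%N -> f i = \sum_(j < M) 'C(j, i)%:R * g j) <->
  (forall j, (j < M)%N -> g j = \sum_(i < M) (-1) ^+ (i + j) * 'C(i, j)%:R * f i).
Proof.
have orth k j : (k < M)%N -> (j < M)%N ->
    \sum_(i < M) (-1) ^+ (k + i) * 'C(k, i)%:R * 'C(i, j)%:R = (k == j)%:R :> R.
  move=> kM jM; rewrite -(sum_sign_bin_bin R k j).
  rewrite (big_ord_widen M (fun i => (-1) ^+ (k - i) * 'C(k, i)%:R * 'C(i, j)%:R)) //.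
  rewrite [RHS]big_mkcond /=; apply: eq_bigr => i _; case: ifPn => ik.
    by rewrite -signr_odd oddD -oddB ?signr_odd.
  by rewrite bin_small ?mulr0 ?mul0r //; lia.
have delta (h : nat -> R) j : (j < M)%N -> \sum_(k < M) (k == j :> nat)%:R * h k = h j.
  move=> jM; rewrite (bigD1 (Ordinal jM)) //= eqxx mul1r big1 ?addr0 // => k ne.
  rewrite (_ : (k == j :> nat) = false) ?mul0r //.
  by apply: contraNF ne => /eqP kj; apply/eqP/val_inj.
split=> h j jM.
- rewrite -[LHS](delta g) //.
  under [RHS]eq_bigr => i _ do rewrite (h i) // mulr_sumr.
  rewrite exchange_big; apply: eq_bigr => k _ /=.
  rewrite -(orth k j) // mulr_suml; have [->|ne] := eqVneq (k : nat) j.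
    by apply: eq_bigr => i _; rewrite addnC; ring.
  (* The sign here is [(-1) ^+ (i + j)] and that of [orth] is [(-1) ^+ (k + i)];
     their quotient does not depend on [i], so the sum still vanishes. *)
  transitivity ((-1) ^+ (k + j) *
    \sum_(i < M) (-1) ^+ (k + i) * 'C(k, i)%:R * 'C(i, j)%:R * g k).
    by rewrite -mulr_suml orth // (negbTE ne) !mul0r mulr0.
  rewrite mulr_sumr; apply: eq_bigr => i _.
  rewrite !exprD; have := sqrr_sign R k; rewrite -signr_odd => s.
  by ring: s.
- rewrite -[LHS](delta f) //.
  under [RHS]eq_bigr => i _ do rewrite (h i) // mulr_sumr.
  rewrite exchange_big; apply: eq_bigr => k _ /=.
  rewrite -(orth k j) // mulr_suml.
  by apply: eq_bigr => i _; ring.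
Qed.

(** * Chebyshev polynomials *)

Lemma deriv_chebyshevU_SS (R : comNzRingType) k :
  (chebyshevU R k.+2)^`() = 2 *: chebyshevU R k.+1 +
     2 *: 'X * (chebyshevU R k.+1)^`() - (chebyshevU R k)^`().
Proof.
rewrite -[chebyshevU R k.+2]/(2 *: 'X * chebyshevU R k.+1 - chebyshevU R k).
by rewrite derivB derivM derivZ derivX -scalerAl mul1r.
Qed.

Lemma chebyshevU_cos (R : realType) (x : R) k :
  sin x * (chebyshevU R k).[cos x] = sin (k.+1%:R * x).
Proof.
suff [] : sin x * (chebyshevU R k).[cos x] = sin (k.+1%:R * x) /\
  sin x * (chebyshevU R k.+1).[cos x] = sin (k.+2%:R * x) by [].
elim: k => [|k [IH1 IH2]].
  split; first by rewrite /= hornerC mul1r mulr1.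
  by rewrite sin_mulSSn mul0r sin0 mul1r /= hornerZ hornerX; ring.
split=> //; rewrite sin_mulSSn -IH1 -IH2.
rewrite -[chebyshevU R k.+2]/(2 *: 'X * chebyshevU R k.+1 - chebyshevU R k).
by rewrite hornerD hornerN hornerM hornerZ hornerX; ring.
Qed.

(** This is the derivative of [chebyshevU_cos] with respect to [x], multiplied by
    [- sin x], with [chebyshevU k] eliminated by [chebyshevU_cos]; the proof follows
    the recurrence rather than differentiating. *)
Lemma deriv_chebyshevU_cos (R : realType) (x : R) k :
  sin x ^+ 3 * (chebyshevU R k)^`().[cos x] =
  cos x * sin (k.+1%:R * x) - k.+1%:R * (sin x * cos (k.+1%:R * x)).
Proof.
suff [] : sin x ^+ 3 * (chebyshevU R k)^`().[cos x] =
    cos x * sin (k.+1%:R * x) - k.+1%:R * (sin x * cos (k.+1%:R * x)) /\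
  sin x ^+ 3 * (chebyshevU R k.+1)^`().[cos x] =
    cos x * sin (k.+2%:R * x) - k.+2%:R * (sin x * cos (k.+2%:R * x)) by [].
have cs := cos2sin2 x.
elim: k => [|k [IH1 IH2]].
  split; first by rewrite /= derivC horner0 mul1r; ring.
  rewrite sin_mulSSn cos_mulSSn !mul0r sin0 cos0 !mul1r.
  by rewrite /= derivZ derivX !hornerE /=; ring: cs.
split=> //; rewrite deriv_chebyshevU_SS hornerD hornerN hornerD mulrBr IH1.
rewrite hornerZ hornerM hornerZ hornerX mulrDr.
rewrite [_ * (2 * cos x * _)]mulrCA IH2.
have -> : sin x ^+ 3 * (2 * (chebyshevU R k.+1).[cos x]) =
    2 * sin x ^+ 2 * sin (k.+2%:R * x) by rewrite -chebyshevU_cos; ring.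
rewrite !sin_mulSSn !cos_mulSSn.
have kx : k%:R * x = k.+1%:R * x - x by rewrite -natr1; ring.
rewrite kx cosB sinB -[k.+3]addn3 -[k.+2]addn2 -[k.+1]addn1 !natrD.
by ring: cs.
Qed.

(** Reflecting the index turns the angle into [pi - (k + 1) x]. *)
Lemma fejer_coef_chebyshev (R : realType) N k : (1 < N)%N -> (k < N)%N ->
  fejer_coef R N (N.-1 - k) =
  (1 - cos (pi / N%:R) ^+ 2) * ((chebyshevU R k)^`()).[cos (pi / N%:R)].
Proof.
move=> N1 kN; rewrite -sin2cos2 /fejer_coef; set x : R := pi / N%:R.
have sx : sin x != 0 := sin_root_neq0 R N1.
have Nk : (N.-1 - k)%:R = N%:R - k.+1%:R :> R.
  by rewrite -natrB //; congr (_%:R); lia.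
have -> : (N.-1 - k)%:R * x = pi - k.+1%:R * x.
  by rewrite Nk mulrBl root_angle_mul.
rewrite Nk cosB sinB cospi sinpi.
apply: (mulfI sx); rewrite [RHS]mulrA -exprS deriv_chebyshevU_cos.
by field.
Qed.

Lemma root_cos_gtN1 (R : realType) N : (1 < N)%N -> 0 < 1 + cos (pi / N%:R) :> R.
Proof.
move=> N1; rewrite lt0r; apply/andP; split.
  apply/eqP => c1; have := sin_root_neq0 R N1; rewrite -sqrf_eq0 sin2cos2.
  by rewrite (_ : cos _ = -1) ?sqrrN ?expr1n ?subrr ?eqxx //; lra.
have := cos_geN1 (pi / N%:R : R); lra.
Qed.

(** * The optimal coefficients *)

(** The substitution [i = J - 2 - k] turns the closed formula for the optimal
    [c_(j+3)] into the inverse binomial transform of the optimal symbol. *)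
Lemma optimal_coef_sum (R : realType) J j (x := pi / J.+1%:R : R) :
  (j < J.-2)%N ->
  (-1) ^+ (J + 1 - j.+3) * (2 ^+ (j.+3 - 1) * (1 - cos x) / J.+1%:R) *
    (\sum_(1 <= k < J.-1)
      (-1) ^+ k * ('C(J - k - 2, j.+3 - 3))%:R * ((chebyshevU R k)^`()).[cos x]) =
  2 ^+ j.+2 * \sum_(i < J.-2) (-1) ^+ (i + j) * 'C(i, j)%:R *
    (fejer_coef R J.+1 i.+2 / (J.+1%:R * (1 + cos x))).
Proof.
move=> jJ.
have c1 : 1 + cos x != 0 by rewrite gt_eqF // root_cos_gtN1; lia.
have NR : J.+1%:R != 0 :> R by rewrite pnatr_eq0.
rewrite big_add1 big_mkord.
rewrite (reindex_inj rev_ord_inj) !mulr_sumr; apply: eq_bigr => i _.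
have iJ := ltn_ord i.
rewrite (_ : (rev_ord i).+1 = J.-2 - i)%N; last by rewrite /=; lia.
rewrite (_ : J - (J.-2 - i) - 2 = i)%N; last by lia.
rewrite !subSS !subn0.
have -> : fejer_coef R J.+1 i.+2 =
    (1 - cos x ^+ 2) * ((chebyshevU R (J.-2 - i))^`()).[cos x].
  rewrite -fejer_coef_chebyshev; try lia.
  by rewrite (_ : J.+1.-1 - (J.-2 - i) = i.+2)%N //; lia.
have sign_eq : (-1) ^+ (J + 1 - j.+3) * (-1) ^+ (J.-2 - i) = (-1) ^+ (i + j) :> R.
  rewrite -exprD -signr_odd -[RHS]signr_odd; congr (_ ^+ nat_of_bool _); lia.
rewrite -sign_eq; move: (J.+1%:R) NR => n NR.
by field; rewrite NR c1.
Qed.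

(** [fejer_coef] normalized so that the constraint [f_0 + f_1 = 1], common to all
    choices of [c], holds. *)
Definition optimal_symbol (R : realType) (J k : nat) : R :=
  fejer_coef R J.+1 k / (J.+1%:R * (1 + cos (pi / J.+1%:R))).

(** Both entries [0] and [1] of the symbol encode [c_2], the entries [2] to [J - 1]
    encode [c_3, ..., c_J] by binomial inversion, and the entry [J] vanishes on both
    sides. *)
Lemma optimal_coefP (R : realType) J (c : nat -> R) (x := pi / J.+1%:R : R) :
  (2 <= J)%N ->
  (c 2%N = 2 * cos x / (1 + cos x) /\
   forall l : nat, (3 <= l <= J)%N ->
     c l = (-1) ^+ (J + 1 - l) * (2 ^+ (l - 1) * (1 - cos x) / J.+1%:R) *
           \sum_(1 <= k < J.-1)
             (-1) ^+ k * ('C(J - k - 2, l - 3))%:R * ((chebyshevU R k)^`()).[cos x]) <->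
  (forall k, (k < J.+1)%N -> ttr_coef J c k = optimal_symbol R J k).
Proof.
move=> J2; have N1 : (1 < J.+1)%N by lia.
have c1 : 1 + cos x != 0 by rewrite gt_eqF // root_cos_gtN1.
have NR : J.+1%:R != 0 :> R by rewrite pnatr_eq0.
have inv := binomial_inversion J.-2 (fun i => optimal_symbol R J i.+2)
  (fun j => 2 ^- j.+2 * c j.+3).
have p2 j : 2 ^+ j != 0 :> R by rewrite expf_neq0 // pnatr_eq0.
have c2P : c 2%N = 2 * cos x / (1 + cos x) ->
    ttr_coef J c 0 = optimal_symbol R J 0 /\ ttr_coef J c 1 = optimal_symbol R J 1.
  move=> c2; rewrite /optimal_symbol fejer_coef0 fejer_coef1 // -/x /= c2.
  by split; move: (J.+1%:R) NR => n NR; field; rewrite ?NR ?c1.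
split=> [[c2 cl] k kJ|h].
- have [h0 h1] := c2P c2; case: k kJ => [//|[//|i]] iJ.
  have [->|iJ'] := eqVneq i.+2 J.
    by rewrite ttr_coef_last // /optimal_symbol (@fejer_coef_pred R J.+1) // mul0r.
  apply/esym; apply: inv.2; last by lia.
  move=> j jJ; rewrite cl; last by lia.
  by rewrite optimal_coef_sum // mulKf.
- split.
    have := h 1%N N1; rewrite /optimal_symbol fejer_coef1 // -/x /= => e.
    have -> : c 2%N = 2 * (c 2%N / 2) by field.
    by rewrite e; move: (J.+1%:R) NR => n NR; field; rewrite NR c1.
  case=> [|[|[|j]]] // /andP[_ jJ].
  rewrite optimal_coef_sum; last by lia.
  apply: (mulfI (invr_neq0 (p2 j.+2))); rewrite mulKf //.
  apply: inv.1; last by lia.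
  by move=> i iJ; rewrite -h //; lia.
Qed.

Lemma cosine_polyZ (R : realType) N (s : R) (f : nat -> R) a :
  cosine_poly N (fun k => f k * s) a = cosine_poly N f a * s.
Proof.
rewrite /cosine_poly [RHS]mulrDl -[2 * _ * s]mulrA mulr_suml.
congr (_ + _ * _).
by apply: eq_bigr => k _; ring.
Qed.

Lemma optimal_symbol_A_stable (R : realType) J (c : nat -> R) : (2 <= J)%N ->
  (forall k, (k < J.+1)%N -> ttr_coef J c k = optimal_symbol R J k) ->
  A_stable J c.
Proof.
move=> J2 h; have N1 : (1 < J.+1)%N by lia.
apply/A_stable_cosine_poly => // a.
rewrite (eq_cosine_poly a (ltn0Sn J) h) cosine_polyZ.
apply: mulr_ge0; first exact: fejer_coef_ge0.
by rewrite invr_ge0 mulr_ge0 // ltW // root_cos_gtN1.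
Qed.

(** The bound [f_1 <= cos x * f_0] reads
    [c_2 / 2 <= cos x * (1 - c_2 / 2)]. *)
Lemma A_stable_c2_le (R : realType) J (c : nat -> R) (x := pi / J.+1%:R : R) :
  (2 <= J)%N -> A_stable J c -> c 2%N <= 2 * cos x / (1 + cos x).
Proof.
move=> J2 /A_stable_cosine_poly-/(_ J2) F0; have N1 : (1 < J.+1)%N by lia.
have c1 : 0 < 1 + cos x by exact: root_cos_gtN1.
have := fejer_ineq N1 (ttr_coef_last c J2) F0.
by rewrite /= -/x ler_pdivlMr //; nra.
Qed.

Lemma A_stable_c2_eq (R : realType) J (c : nat -> R) (x := pi / J.+1%:R : R) :
  (2 <= J)%N -> A_stable J c -> c 2%N = 2 * cos x / (1 + cos x) ->
  forall k, (k < J.+1)%N -> ttr_coef J c k = optimal_symbol R J k.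
Proof.
move=> J2 /A_stable_cosine_poly-/(_ J2) F0 c2 k kJ; have N1 : (1 < J.+1)%N by lia.
have c1 : 1 + cos x != 0 by rewrite gt_eqF // root_cos_gtN1.
have NR : J.+1%:R != 0 :> R by rewrite pnatr_eq0.
have f0 : ttr_coef J c 0 = (1 + cos x)^-1 by rewrite /= c2; field.
have f1 : ttr_coef J c 1 = cos x * ttr_coef J c 0 by rewrite /= c2; field.
case: k kJ => [|k] kJ.
  rewrite f0 /optimal_symbol fejer_coef0 -/x; move: (J.+1%:R) NR => n NR.
  by field; rewrite NR c1.
rewrite (fejer_eq N1 (ttr_coef_last c J2) F0 f1) // f0 /optimal_symbol -/x.
move: (fejer_coef _ _ _) => e; move: (J.+1%:R) NR => n NR.
by field; rewrite NR c1.
Qed.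

Theorem theorem3p1 (R : realType) (J : nat) (c : nat -> R) (hJ : (2 <= J)%N) :
  let x : R := pi / J.+1%:R in
  optimal J c <->
  (c 2%N = 2 * cos x / (1 + cos x) /\
   forall l : nat, (3 <= l <= J)%N ->
     c l = (-1) ^+ (J + 1 - l) * (2 ^+ (l - 1) * (1 - cos x) / J.+1%:R) *
           \sum_(1 <= k < J.-1)
             (-1) ^+ k * ('C(J - k - 2, l - 3))%:R * ((chebyshevU R k)^`()).[cos x]).
Proof.
move=> x; split=> [[st opt]|hc].
  (* An explicit A-stable competitor shows that the bound on [c_2] is attained. *)
  pose d l : R := if l == 2%N then 2 * cos x / (1 + cos x) else
     (-1) ^+ (J + 1 - l) * (2 ^+ (l - 1) * (1 - cos x) / J.+1%:R) *
           \sum_(1 <= k < J.-1)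
             (-1) ^+ k * ('C(J - k - 2, l - 3))%:R * ((chebyshevU R k)^`()).[cos x].
  have d_st : A_stable J d.
    apply: optimal_symbol_A_stable => //; apply/optimal_coefP => //.
    by split=> // l hl; rewrite /d (_ : (l == 2%N) = false) //; lia.
  have c2 : c 2%N = 2 * cos x / (1 + cos x).
    by apply/le_anti; rewrite A_stable_c2_le //= -[leLHS]/(d 2%N) opt.
  by apply/optimal_coefP => //; exact: A_stable_c2_eq.
split=> [|d d_st].
  by apply: optimal_symbol_A_stable => //; apply/optimal_coefP.
by case: hc => -> _; exact: A_stable_c2_le.
Qed.
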